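(* Let $L$ be a finite-dimensional Lie algebra over a field $F$. 1. $L$ is primitive of type 1 if and only if $L$ is monolithic with abelian monolith $W$ and $\phi(L) = 0$. 2. If $F$ has characteristic zero, then $L$ is primitive of type 1 if and only if $L = W \ltimes (C \oplus S)$, where $W$ is the abelian monolith of $L$ (an ideal of $L$), $C$ is an abelian subalgebra of $L$ every element of which acts semisimply on $W$, and $S$ is a Levi subalgebra of $L$. 3. If $L$ is solvable, then $L$ is primitive if and only if it has a self-centralising minimal ideal.
   Context: The core $U_L$ of a subalgebra $U$ is the largest ideal of $L$ contained in $U$; $U$ is core-free if $U_L=0$. $L$ is primitive if it has a core-free maximal subalgebra. A primitive Lie algebra is of type 1 if it has a unique minimal ideal and that ideal is abelian. $L$ is monolithic if it has a unique minimal ideal (its monolith). The Frattini ideal $\phi(L)$ is the largest ideal of $L$ contained in the intersection of all maximal subalgebras of $L$. An ideal $A$ is self-centralising if $C_L(A) = \{x\in L : [x,A]=0\} = A$. *)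

(* Defs.v *)
From HB Require Import structures.
From mathcomp Require Import all_boot all_order all_algebra.
Set Implicit Arguments. Unset Strict Implicit. Unset Printing Implicit Defensive.
Import GRing.Theory.
Local Open Scope ring_scope.

Section Lie.
Variables (F : fieldType) (L : vectType F) (br : L -> L -> L).

Definition lie_algebra : Prop :=
  [/\ (forall (a : F) x y z, br (a *: x + y) z = a *: br x z + br y z),
      (forall (a : F) x y z, br x (a *: y + z) = a *: br x y + br x z),
      (forall x, br x x = 0) &
      (forall x y z, br x (br y z) + br y (br z x) + br z (br x y) = 0)].

(* [U, V] : the subspace spanned by all brackets [u, v], u in U, v in V
   (spanned by brackets of basis vectors, by bilinearity). *)
Definition lie_brsp (U V : {vspace L}) : {vspace L} :=
  <<allpairs br (vbasis U) (vbasis V)>>%VS.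

Definition subalg (U : {vspace L}) : Prop :=
  forall x y, x \in U -> y \in U -> br x y \in U.

Definition ideal (I : {vspace L}) : Prop :=
  forall x y, y \in I -> br x y \in I.

Definition abelian (U : {vspace L}) : Prop :=
  forall x y, x \in U -> y \in U -> br x y = 0.

Definition solvable (U : {vspace L}) : Prop :=
  exists n, iter n (fun V => lie_brsp V V) U = 0%VS.

Definition maximal_subalg (M : {vspace L}) : Prop :=
  [/\ subalg M, M != fullv &
      forall V, subalg V -> (M <= V)%VS -> V = M \/ V = fullv].

Definition core_free (U : {vspace L}) : Prop :=
  forall I, ideal I -> (I <= U)%VS -> I = 0%VS.

Definition primitive : Prop :=
  exists M, maximal_subalg M /\ core_free M.

Definition minimal_ideal (I : {vspace L}) : Prop :=
  [/\ ideal I, I != 0%VS &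
      forall J, ideal J -> (J <= I)%VS -> J = 0%VS \/ J = I].

Definition monolith (W : {vspace L}) : Prop :=
  minimal_ideal W /\ forall J, minimal_ideal J -> J = W.

Definition monolithic : Prop := exists W, monolith W.

Definition primitive_type1 : Prop :=
  primitive /\ exists W, monolith W /\ abelian W.

(* phi(L) = 0 : the largest ideal contained in the intersection of all maximal
   subalgebras is zero, i.e. every such ideal is zero. *)
Definition frattini_free : Prop :=
  forall I, ideal I -> (forall M, maximal_subalg M -> (I <= M)%VS) -> I = 0%VS.

Definition self_centralising (A : {vspace L}) : Prop :=
  forall x, x \in A <-> (forall a, a \in A -> br x a = 0).

Definition radical (R : {vspace L}) : Prop :=
  [/\ ideal R, solvable R & forall I, ideal I -> solvable I -> (I <= R)%VS].

Definition levi (S : {vspace L}) : Prop :=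
  exists R, [/\ radical R, subalg S, directv (R + S) & (R + S)%VS = fullv].

(* ad x acts semisimply on the (ad x)-invariant subspace W: every
   (ad x)-invariant subspace of W has an (ad x)-invariant complement in W
   (i.e. W is a completely reducible F[ad x]-module). *)
Definition acts_semisimply (x : L) (W : {vspace L}) : Prop :=
  forall U, (U <= W)%VS -> (forall u, u \in U -> br x u \in U) ->
  exists V : {vspace L}, [/\ (V <= W)%VS, (forall v, v \in V -> br x v \in V),
                            directv (U + V) & (U + V)%VS = W].

End Lie.

(* Main.v *)
(* If M is a core-free maximal subalgebra and A an abelian minimal ideal, then
   A is a self-centralising complement of M, since A :&: M and C_L(A) :&: M are
   ideals of L inside M; this gives one direction of the solvable case. For the
   other, take B the last term of the derived series not inside A. Commuting
   nilpotent operators have a common kernel, so some b in B is not ad-nilpotent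
   on A, and a maximal subalgebra above the Fitting null component of ad b is
   core-free.
   In characteristic zero, neither Levi's nor Weyl's theorem is needed: M acts
   faithfully and irreducibly on W, and a sum y of brackets [u, v] with every v
   commuting with y has \tr (ad y ^+ k) = 0 for k > 0, hence is ad-nilpotent.
   It follows that [M, M] meets the centre C of M trivially and that abelian
   ideals of M are central, so W + C is the radical of L and every complement
   of C in M that contains [M, M] is a Levi subalgebra. *)
Require Import Defs.
From Stdlib Require Import Classical_Prop.
From mathcomp Require Import all_boot all_order all_algebra.
Set Implicit Arguments. Unset Strict Implicit. Unset Printing Implicit Defensive.
Import GRing.Theory.
Local Open Scope ring_scope.

(** * Extremal subspaces, and subspaces cut out by linear predicates *)

Section Subspaces.
Variables (F : fieldType) (L : vectType F).
Implicit Types (P : {vspace L} -> Prop) (U V X : {vspace L}).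

(** Induction on the dimension; the case split is classical because [P] is an arbitrary
    proposition. *)
Lemma ex_min_vspace P V : P V ->
  exists U, [/\ P U, (U <= V)%VS & forall X, P X -> (X <= U)%VS -> X = U].
Proof.
have [n] := ubnP (\dim V); elim: n V => // n IHn V ltV PV.
case: (classic (exists X, [/\ P X, (X <= V)%VS & X <> V])) => [[X [PX sXV neXV]]|noX].
  have [|U [PU sUX minU]] := IHn X _ PX.
    rewrite -ltnS (leq_trans _ ltV) // ltnS ltn_neqAle dimvS // andbT.
    by apply/eqP => eqd; apply: neXV; apply/eqP; rewrite eqEdim sXV eqd leqnn.
  by exists U; split=> //; apply: subv_trans sXV.
exists V; split=> // X PX sXV; apply: NNPP => neX.
by apply: noX; exists X.
Qed.

Lemma ex_max_vspace P V : P V ->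
  exists U, [/\ P U, (V <= U)%VS & forall X, P X -> (U <= X)%VS -> X = U].
Proof.
have [n] := ubnP (\dim {:L} - \dim V); elim: n V => // n IHn V ltV PV.
case: (classic (exists X, [/\ P X, (V <= X)%VS & X <> V])) => [[X [PX sVX neXV]]|noX].
  have [|U [PU sXU maxU]] := IHn X _ PX.
    rewrite -ltnS (leq_trans _ ltV) // ltnS ltn_sub2l //; last first.
      rewrite ltn_neqAle dimvS // andbT.
      by apply/eqP => eqd; apply/neXV/esym/eqP; rewrite eqEdim sVX eqd leqnn.
    rewrite ltn_neqAle dimvS ?subvf // andbT; apply/eqP => eqd.
    apply: neXV; apply/eqP; rewrite eqEsubv sVX andbT.
    suff -> : V = fullv by apply: subvf.
    by apply/eqP; rewrite eqEdim subvf eqd leqnn.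
  by exists U; split=> //; apply: subv_trans sXU.
exists V; split=> // X PX sXV; apply: NNPP => neX.
by apply: noX; exists X.
Qed.

(** Supplies the kernels, images, preimages and centralisers used below. A maximal subspace inside
    [P] absorbs every [x] satisfying [P], since adjoining the line of [x] stays inside [P]. *)
Lemma ex_vspace (P : L -> Prop) :
    P 0 -> (forall (a : F) x y, P x -> P y -> P (a *: x + y)) ->
  exists V : {vspace L}, forall x, x \in V <-> P x.
Proof.
move=> P0 PD; pose Q (V : {vspace L}) := forall x, x \in V -> P x.
have [|V [QV _ maxV]] := @ex_max_vspace Q 0%VS.
  by move=> x; rewrite memv0 => /eqP ->.
exists V => x; split=> [/QV //|Px].
rewrite -(maxV (<[x]> + V)%VS) ?addvSr //.
  by rewrite (subvP (addvSl _ _)) ?memv_line.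
by move=> _ /memv_addP [_ /vlineP [a ->] [v /QV Pv ->]]; apply: PD.
Qed.

Lemma eq_fullv V : (fullv <= V)%VS -> V = fullv.
Proof. by move=> sfV; apply/eqP; rewrite eqEsubv subvf. Qed.

End Subspaces.

(* A power B of A of stable rank is C *m R with G = R *m C invertible, and
   \tr (B ^+ j) = \tr (G ^+ j) for j > 0; taking traces in Cayley-Hamilton for G
   leaves only the constant term, so the size of G is 0. *)
Lemma trace_powers_nilpotent (F : fieldType) (n : nat) (A : 'M[F]_n) :
    [pchar F] =i pred0 -> (forall k, \tr (A ^+ k.+1) = 0) ->
  exists k, A ^+ k = 0.
Proof.
move=> char0 trA.
have [k [k_gt0 rkA]] : exists k, (0 < k)%N /\ \rank (A ^+ k) = \rank (A ^+ (k + k)).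
  suff stab r k : (0 < k)%N -> (\rank (A ^+ k) < r)%N ->
      exists k, (0 < k)%N /\ \rank (A ^+ k) = \rank (A ^+ (k + k)).
    exact: (stab _ 1%N isT (ltnSn _)).
  elim: r k => // r IHr k k_gt0 rk_r.
  have := mxrankM_maxl (A ^+ k) (A ^+ k); rewrite mulmxE -exprD leq_eqVlt.
  case/orP=> [/eqP eqr|ltr]; first by exists k.
  by apply: (IHr (k + k)%N); rewrite ?addn_gt0 ?k_gt0 // -ltnS (leq_trans _ rk_r).
exists k; set B := A ^+ k in rkA *.
have trB j : \tr (B ^+ j.+1) = 0.
  by rewrite /B -exprM -(prednK (n := k * j.+1)) ?muln_gt0 ?k_gt0.
rewrite exprD -mulmxE -/B in rkA.
have [r [C [R [Cfull Rfree BE rkB]]]] : exists r (C : 'M_(n, r)) (R : 'M_(r, n)),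
    [/\ row_full C, row_free R, B = C *m R & \rank B = r].
  exists (\rank B), (col_base B), (row_base B).
  by split; rewrite ?col_base_full ?row_base_free ?mulmx_base.
pose G := R *m C.
have rkG : \rank G = r.
  rewrite -[RHS]rkB rkA {1 2}BE -mulmxA (mulmxA R) -/G.
  by rewrite (eqmxMfull _ Cfull) mxrankMfree.
have BX j : B ^+ j.+1 = C *m G ^+ j *m R.
  elim: j => [|j IHj]; first by rewrite expr1 expr0 mulmx1.
  by rewrite exprSr IHj {1}BE exprSr -!mulmxE !mulmxA.
have trG j : \tr (G ^+ j.+1) = 0.
  by rewrite -(trB j) BX mxtrace_mulC mulmxA mulmxE -exprS.
have Gunit : G \in unitmx by rewrite -row_free_unit /row_free rkG.
(* For [r = 0] the factorisation gives [A ^+ k = 0]; a positive size is contradictory. *)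
case: r C R {Cfull Rfree rkB} @G BE rkG {BX} trG Gunit => [|r] C R G BE rkG trG Gunit.
  by rewrite BE [C]thinmx0 mul0mx.
have := congr1 mxtrace (Cayley_Hamilton G).
rewrite -[char_poly G]coefK poly_def size_char_poly big_ord_recl !linearD /=.
rewrite !linearZ /= expr0 rmorph1 mxtrace1 raddf_sum raddf_sum big1 /= => [|i _].
  rewrite addr0 mxtrace0 => /eqP; rewrite mulf_eq0 char_poly_det mulf_eq0.
  rewrite signr_eq0 /= -[\det G == 0]negbK -unitfE -unitmxE Gunit /=.
  by move/pcharf0P: char0 => ->.
by rewrite !linearZ /= rmorphXn /= horner_mx_X trG mulr0.
Qed.

(** * Bracket calculus and ideals *)

Section LieAlgebra.
Variables (F : fieldType) (L : vectType F) (br : L -> L -> L).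
Hypothesis hL : lie_algebra br.
Implicit Types (U V W X M A B C I J K S : {vspace L}) (x y z u v w : L).

Lemma brP (a : F) x y z : br (a *: x + y) z = a *: br x z + br y z.
Proof. by case: hL. Qed.

Lemma brPr (a : F) x y z : br x (a *: y + z) = a *: br x y + br x z.
Proof. by case: hL. Qed.

Lemma brxx x : br x x = 0.
Proof. by case: hL. Qed.

Lemma brDl x y z : br (x + y) z = br x z + br y z.
Proof. by have := brP 1 x y z; rewrite !scale1r. Qed.

Lemma brDr x y z : br x (y + z) = br x y + br x z.
Proof. by have := brPr 1 x y z; rewrite !scale1r. Qed.

Lemma br0l x : br 0 x = 0.
Proof. by apply: (addrI (br 0 x)); rewrite -brDl !addr0. Qed.

Lemma br0r x : br x 0 = 0.
Proof. by apply: (addrI (br x 0)); rewrite -brDr !addr0. Qed.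

Lemma brZl (a : F) x y : br (a *: x) y = a *: br x y.
Proof. by rewrite -[a *: x]addr0 brP br0l addr0. Qed.

Lemma brZr (a : F) x y : br x (a *: y) = a *: br x y.
Proof. by rewrite -[a *: y]addr0 brPr br0r addr0. Qed.

Lemma brC x y : br x y = - br y x.
Proof.
apply/eqP; rewrite -addr_eq0; apply/eqP.
by have := brxx (x + y); rewrite brDl !brDr !brxx add0r addr0.
Qed.

Lemma brNr x y : br x (- y) = - br x y.
Proof. by rewrite -scaleN1r brZr scaleN1r. Qed.

Lemma br_deriv x y z : br x (br y z) = br (br x y) z + br y (br x z).
Proof.
case: hL => _ _ _ /(_ x y z) /eqP.
rewrite addrAC addr_eq0 => /eqP eqJ.
have -> : br x (br y z) = (br x (br y z) + br z (br x y)) - br z (br x y).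
  by rewrite addrK.
by rewrite eqJ (brC z x) brNr opprK (brC z (br x y)) opprK addrC.
Qed.

Lemma idealC I x y : ideal br I -> y \in I -> br y x \in I.
Proof. by move=> idI yI; rewrite brC memvN idI. Qed.

Lemma br_sumr x n (f : 'I_n -> F) (g : 'I_n -> L) :
  br x (\sum_i f i *: g i) = \sum_i f i *: br x (g i).
Proof.
elim/big_rec2: _ => [|i y1 y2 _ <-]; first exact: br0r.
by rewrite brPr.
Qed.

Lemma br_suml x n (f : 'I_n -> F) (g : 'I_n -> L) :
  br (\sum_i f i *: g i) x = \sum_i f i *: br (g i) x.
Proof.
elim/big_rec2: _ => [|i y1 y2 _ <-]; first exact: br0l.
by rewrite brP.
Qed.

Lemma mem_lie_brsp U V x y : x \in U -> y \in V -> br x y \in lie_brsp br U V.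
Proof.
move=> xU yV; rewrite (coord_vbasis xU) (coord_vbasis yV) br_suml.
apply: memv_suml => i _; apply: memvZ; rewrite br_sumr.
apply: memv_suml => j _; apply: memvZ; apply: memv_span.
by apply/allpairsP; exists ((vbasis U)`_i, (vbasis V)`_j); rewrite /= !mem_nth ?size_tuple.
Qed.

Lemma lie_brsp_sub U V X :
  (forall x y, x \in U -> y \in V -> br x y \in X) -> (lie_brsp br U V <= X)%VS.
Proof.
move=> UVX; apply/span_subvP => _ /allpairsP [[x y] /= [xU yV ->]].
by apply: UVX; apply: vbasis_mem.
Qed.

(** By linearity it is enough to treat brackets, where Jacobi applies. Fixing one [x] serves ideals
    of [L] and also subspaces stable only under a subalgebra. *)
Lemma lie_brsp_stable x U V :
    (forall y, y \in U -> br x y \in U) -> (forall y, y \in V -> br x y \in V) ->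
  forall y, y \in lie_brsp br U V -> br x y \in lie_brsp br U V.
Proof.
move=> xU xV.
have [X XP] : exists X : {vspace L}, forall y, y \in X <-> br x y \in lie_brsp br U V.
  apply: ex_vspace => [|a y z yX zX]; first by rewrite br0r mem0v.
  by rewrite brPr memvD ?memvZ.
suff /subvP sX : (lie_brsp br U V <= X)%VS by move=> y /sX /XP.
apply: lie_brsp_sub => y z yU zV; apply/XP.
by rewrite br_deriv memvD // mem_lie_brsp // ?xU ?xV.
Qed.

Lemma ideal_lie_brsp I J : ideal br I -> ideal br J -> ideal br (lie_brsp br I J).
Proof. by move=> idI idJ x; apply: lie_brsp_stable => y; [apply: idI|apply: idJ]. Qed.

Lemma ideal_full : ideal br fullv.
Proof. by move=> x y _; apply: memvf. Qed.

Lemma ideal_add I J : ideal br I -> ideal br J -> ideal br (I + J)%VS.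
Proof.
by move=> iI iJ x _ /memv_addP [u uI [v vJ ->]]; rewrite brDr memv_add ?iI ?iJ.
Qed.

Lemma subalg_add_ideal I U : ideal br I -> subalg br U -> subalg br (I + U)%VS.
Proof.
move=> iI sU _ _ /memv_addP [i iI' [u uU ->]] /memv_addP [j jI [v vU ->]].
rewrite brDl (brDr u) addrA memv_add ?sU //.
by apply: memvD; [apply: idealC|apply: iI].
Qed.

(** * Centralisers, minimal ideals and maximal subalgebras *)

Lemma centraliserE V :
  exists Z : {vspace L}, forall x, x \in Z <-> (forall v, v \in V -> br x v = 0).
Proof.
apply: ex_vspace => [v _|a x y x0 y0 v vV]; first exact: br0l.
by rewrite brP x0 // y0 // scaler0 addr0.
Qed.

Lemma minimal_ideal_exists I : ideal br I -> I != 0%VS ->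
  exists2 W, minimal_ideal br W & (W <= I)%VS.
Proof.
move=> iI I0.
have [|W [[iW W0] sWI minW]] := @ex_min_vspace _ _ (fun W => ideal br W /\ W != 0%VS) I.
  by [].
exists W => //; split=> // J iJ sJW.
by have [->|J0] := eqVneq J 0%VS; [left|right; apply: minW].
Qed.

Lemma maximal_subalg_exists U : subalg br U -> U <> fullv ->
  exists2 M, maximal_subalg br M & (U <= M)%VS.
Proof.
move=> sU Uf.
have [|M [[sM Mf] sUM maxM]] :=
  @ex_max_vspace _ _ (fun W => subalg br W /\ W <> fullv) U; first by [].
exists M => //; split=> [//||V sV sMV]; first exact/eqP.
by case: (classic (V = fullv)) => Vf; [right|left; apply: maxM].
Qed.

Lemma monolith_sub W I : monolith br W -> ideal br I -> I != 0%VS -> (W <= I)%VS.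
Proof.
by move=> [_ uniqW] iI I0; have [J minJ] := minimal_ideal_exists iI I0; rewrite (uniqW _ minJ).
Qed.

Lemma maximal_add_ideal M I :
  maximal_subalg br M -> ideal br I -> ~ (I <= M)%VS -> (I + M)%VS = fullv.
Proof.
move=> [sM _ maxM] iI nsIM.
case: (maxM (I + M)%VS); rewrite ?addvSr //; first exact: subalg_add_ideal.
by move=> eqM; case: nsIM; rewrite -eqM addvSl.
Qed.

(** The [A]-component of any element kills [I], as [A] is abelian and contains [I]; only the action
    of [M] remains. *)
Lemma ideal_of_stable A M I :
    abelian br A -> (A + M)%VS = fullv -> (I <= A)%VS ->
    (forall m x, m \in M -> x \in I -> br m x \in I) ->
  ideal br I.
Proof.
move=> abA AMf sIA stI x y yI.
have /memv_addP [a aA [m mM ->]] : x \in (A + M)%VS by rewrite AMf memvf.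
by rewrite brDl abA ?(subvP sIA _ yI) // add0r stI.
Qed.

Lemma maximal_cap_ideal M A :
    maximal_subalg br M -> ideal br A -> abelian br A -> ~ (A <= M)%VS ->
  ideal br (A :&: M)%VS.
Proof.
move=> maxM iA abA nsAM; apply: (@ideal_of_stable A M) => //.
- exact: maximal_add_ideal.
- exact: capvSl.
case: maxM => sM _ _ m x mM; rewrite !memv_cap => /andP [xA xM].
by rewrite iA ?sM.
Qed.

Lemma core_free_complement M A :
    maximal_subalg br M -> core_free br M -> minimal_ideal br A -> abelian br A ->
  [/\ (A + M)%VS = fullv, (A :&: M)%VS = 0%VS & self_centralising br A].
Proof.
move=> maxM cfM [iA A0 minA] abA.
have nsAM : ~ (A <= M)%VS by move=> /cfM-/(_ iA) /eqP; apply/negP.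
have AMf := maximal_add_ideal maxM iA nsAM.
have AM0 : (A :&: M)%VS = 0%VS.
  by apply: cfM; [apply: maximal_cap_ideal | apply: capvSr].
split=> // x; split=> [xA a aA|xA]; first exact: abA.
have [Z ZP] := centraliserE A.
(* Elements of [Z] commute with [A], so again only [M] acts on [Z :&: M]; by Jacobi it preserves
   [Z]. *)
have ZM0 : (Z :&: M)%VS = 0%VS.
  apply: cfM; last exact: capvSr.
  move=> y z; rewrite memv_cap => /andP [/ZP zA zM].
  have /memv_addP [a aA [m mM ->]] : y \in (A + M)%VS by rewrite AMf memvf.
  rewrite brDl [br a z]brC zA // oppr0 add0r memv_cap.
  case: maxM => sM _ _; rewrite sM // andbT; apply/ZP => b bA.
  have := br_deriv m z b; rewrite !zA ?iA // br0r addr0 => <-; exact.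
(* Since [A] is abelian, the [M]-component of [x] also centralises [A], hence vanishes. *)
have /memv_addP [a aA [m mM eqx]] : x \in (A + M)%VS by rewrite AMf memvf.
have : m \in (Z :&: M)%VS.
  rewrite memv_cap mM andbT; apply/ZP => b bA.
  by have := xA b bA; rewrite eqx brDl abA // add0r.
by rewrite ZM0 memv0 => /eqP m0; rewrite eqx m0 addr0.
Qed.

Lemma monolith_core_free M W :
  monolith br W -> ~ (W <= M)%VS -> core_free br M.
Proof.
move=> monW nsWM I iI sIM; apply/eqP; rewrite -[_ == _]negbK; apply/negP => I0.
by apply: nsWM; apply: subv_trans sIM; apply: monolith_sub.
Qed.

(** An ideal lying in all maximal subalgebras lies in the core-free one. Conversely, if
    [phi(L) = 0], some maximal subalgebra misses [W]; it is core-free because every nonzero ideal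
    contains the monolith. *)
Lemma primitive_type1_frattini :
  primitive_type1 br <->
  (exists W, monolith br W /\ abelian br W) /\ frattini_free br.
Proof.
split=> [[[M [maxM cfM]] exW]|[[W [monW abW]] ffree]].
  by split=> // I iI subI; apply: cfM => //; apply: subI.
split; last by exists W.
have [[iW /eqP W0 _] _] := monW.
have [M maxM nsWM] : exists2 M, maximal_subalg br M & ~ (W <= M)%VS.
  apply: NNPP => noM; apply: W0; apply: ffree => // M maxM.
  by apply: NNPP => nsWM; apply: noM; exists M.
by exists M; split=> //; apply: monolith_core_free nsWM.
Qed.

(** * Nilpotent actions on abelian minimal ideals *)

Lemma nilpotent_common_kernel K W :
    W != 0%VS ->
    (forall k w, k \in K -> w \in W -> br k w \in W) ->
    (forall k l w, k \in K -> l \in K -> w \in W ->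
       br k (br l w) = br l (br k w)) ->
    (forall k w, k \in K -> w \in W -> exists n, iter n (br k) w = 0) ->
  exists w, [/\ w \in W, w != 0 & forall k, k \in K -> br k w = 0].
Proof.
move=> W0 stW comW nilW.
(* On a minimal nonzero [K]-stable [U], the kernel of each [k] is nonzero by nilpotency and stable
   by commutation, so it is all of [U]. *)
pose P U := [/\ U != 0%VS, (U <= W)%VS & forall k u, k \in K -> u \in U -> br k u \in U].
have [|U [[U0 sUW stU] _ minU]] := @ex_min_vspace _ _ P W; first by split.
exists (vpick U); split; rewrite ?vpick0 ?(subvP sUW) ?memv_pick // => k kK.
have [X XP] : exists X : {vspace L}, forall x, x \in X <-> x \in U /\ br k x = 0.
  apply: ex_vspace => [|a x y [xU x0] [yU y0]]; first by rewrite mem0v br0r.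
  by rewrite memvD ?memvZ // brPr x0 y0 scaler0 addr0.
suff eqX : X = U by have /XP [] : vpick U \in X by rewrite eqX memv_pick.
have sXU : (X <= U)%VS by apply/subvP => x /XP [].
apply: minU => //; split.
(* Applying [br k] to a nonzero vector until it vanishes, the last nonzero iterate lies in [X]. *)
- have [n] := nilW k _ kK (subvP sUW _ (memv_pick U)).
  have : vpick U \in U := memv_pick U.
  have : vpick U != 0 by rewrite vpick0.
  elim: n (vpick U) => [|n IHn] u u0 uU; first by move=> /= /eqP; rewrite (negPf u0).
  have [ku0 _|ku0] := eqVneq (br k u) 0.
    apply: contraNneq u0 => X0; rewrite -memv0 -X0; exact/XP.
  by rewrite iterSr; apply: IHn => //; apply: stU.
- exact: subv_trans sUW.
move=> l u lK /XP [uU u0]; apply/XP; split; first exact: stU.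
by rewrite comW ?(subvP sUW) // u0 br0r.
Qed.

(** The vectors of [A] killed by [K] form an ideal, because [M] normalises [K]; it is nonzero by the
    common kernel, hence equal to [A]. *)
Lemma nilpotent_centralises A M K :
    minimal_ideal br A -> abelian br A -> (A + M)%VS = fullv ->
    (forall m k, m \in M -> k \in K -> br m k \in K) ->
    (forall k l a, k \in K -> l \in K -> a \in A -> br (br k l) a = 0) ->
    (forall k a, k \in K -> a \in A -> exists n, iter n (br k) a = 0) ->
  forall k a, k \in K -> a \in A -> br k a = 0.
Proof.
move=> [iA A0 minA] abA AMf stK comK nilK.
have [||w [wA w0 Kw]] := nilpotent_common_kernel A0 _ _ nilK.
- by move=> k w _; apply: iA.
- by move=> k l w kK lK wA; rewrite br_deriv comK // add0r.
have [X XP] : exists X : {vspace L}, forall x, x \in X <->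
    x \in A /\ forall k, k \in K -> br k x = 0.
  apply: ex_vspace => [|a x y [xA x0] [yA y0]].
    by split=> [|k _]; rewrite ?mem0v ?br0r.
  by split=> [|k kK]; rewrite ?memvD ?memvZ // brPr x0 // y0 // scaler0 addr0.
have sXA : (X <= A)%VS by apply/subvP => x /XP [].
have [||X0|<-] // := minA X; last 1 first.
- by move=> k a kK /XP [_ /(_ k kK)].
- apply: (ideal_of_stable abA AMf sXA) => m x mM /XP [xA Kx]; apply/XP.
  split=> [|k kK]; first exact: iA.
  by rewrite br_deriv [br k m]brC -scaleN1r brZl !Kx ?stK // scaler0 add0r br0r.
suff : w \in 0%VS by rewrite memv0 (negPf w0).
by rewrite -X0; apply/XP.
Qed.

(** * Derived series and solvable ideals *)

Local Notation derived V := (lie_brsp br V V).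

Lemma derivedS U V : (U <= V)%VS -> (derived U <= derived V)%VS.
Proof.
move=> /subvP sUV; apply: lie_brsp_sub => x y /sUV xV /sUV yV.
exact: mem_lie_brsp.
Qed.

Lemma solvableS U V : (U <= V)%VS -> solvable br V -> solvable br U.
Proof.
move=> sUV [n Vn]; exists n; apply/eqP; rewrite -subv0 -Vn.
by elim: n {Vn} => //= n IHn; apply: derivedS.
Qed.

(** [B] is the last term of the derived series of [I] not contained in [A]. *)
Lemma solvable_abelian_section A I : ideal br I -> solvable br I -> ~ (I <= A)%VS ->
  exists B, [/\ ideal br B, (B <= I)%VS, ~ (B <= A)%VS & (derived B <= A)%VS].
Proof.
move=> iI [n In] nsIA.
have [m [sm nsm]] : exists m, (iter m.+1 (fun V => derived V) I <= A)%VS /\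
    ~ (iter m (fun V => derived V) I <= A)%VS.
  have : (iter n (fun V => derived V) I <= A)%VS by rewrite In sub0v.
  elim: n {In} => [//|n IHn] sn.
  by case: (classic (iter n (fun V => derived V) I <= A)%VS) => [/IHn //|]; exists n.
exists (iter m (fun V => derived V) I); split=> //.
  by elim: m {sm nsm} => //= m IHm; apply: ideal_lie_brsp.
elim: m {sm nsm} => [|m IHm] /=; first exact: subvv.
apply: subv_trans (derivedS IHm) _.
by apply: lie_brsp_sub => x y _; apply: iI.
Qed.

Lemma solvable_minimal_abelian A :
  solvable br fullv -> minimal_ideal br A -> abelian br A.
Proof.
move=> solL [iA A0 minA].
have [|B [iB sBA nsB0 dB]] :=
  solvable_abelian_section (A := 0%VS) iA (solvableS (subvf A) solL).
  by rewrite subv0; apply/negP.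
case: (minA B iB sBA) => [B0|BA]; first by rewrite B0 sub0v in nsB0.
move=> x y; rewrite -BA => xB yB; apply/eqP; rewrite -memv0.
by apply: (subvP dB); apply: mem_lie_brsp.
Qed.

(** * Fitting null component and the solvable case *)

Lemma iter_br_lin n b (a : F) x y :
  iter n (br b) (a *: x + y) = a *: iter n (br b) x + iter n (br b) y.
Proof. by elim: n => //= n ->; rewrite brPr. Qed.

Lemma iter_brD n b x y : iter n (br b) (x + y) = iter n (br b) x + iter n (br b) y.
Proof. by have := iter_br_lin n b 1 x y; rewrite !scale1r. Qed.

Lemma iter_br0 n b : iter n (br b) 0 = 0.
Proof. by elim: n => //= n ->; rewrite br0r. Qed.

Lemma iter_br_eq0 n m b x : (n <= m)%N -> iter n (br b) x = 0 -> iter m (br b) x = 0.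
Proof. by move=> /subnK <- x0; rewrite iterD x0 iter_br0. Qed.

(** Leibniz rule: each term of the expansion applies [br b] at least [n] times to [x] or at least
    [m] times to [y]. *)
Lemma iter_br_br n m b x y : iter n (br b) x = 0 -> iter m (br b) y = 0 ->
  iter (n + m) (br b) (br x y) = 0.
Proof.
elim: n m x y => [|n IHn] m x y; first by move=> /= -> _; rewrite br0l iter_br0.
elim: m y => [|m IHm] y x0 y0; first by rewrite (y0 : y = 0) br0r iter_br0.
rewrite addSn iterSr br_deriv iter_brD IHn -?iterSr // add0r.
by rewrite -addSnnS IHm // -iterSr.
Qed.

(* Fitting decomposition of ad b: its one-component lies in A because (ad b)^2
   maps L into A. *)
Lemma fitting_null_component b A : (forall x, br b (br b x) \in A) ->
  exists N, [/\ subalg br N, (A + N)%VS = fullv &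
    forall x, x \in N <-> exists n, iter n (br b) x = 0].
Proof.
move=> bbA.
have [N NP] : exists N : {vspace L}, forall x, x \in N <-> exists n, iter n (br b) x = 0.
  apply: ex_vspace => [|a x y [n xn] [m ym]]; first by exists 0%N.
  exists (maxn n m); rewrite iter_br_lin.
  by rewrite (iter_br_eq0 (leq_maxl _ _) xn) (iter_br_eq0 (leq_maxr _ _) ym) scaler0 addr0.
exists N; split=> // [x y /NP [n xn] /NP [m ym]|].
  by apply/NP; exists (n + m)%N; apply: iter_br_br.
have imE k : exists V : {vspace L}, forall v, v \in V <-> exists x, v = iter k (br b) x.
  apply: ex_vspace => [|a _ _ [x ->] [y ->]]; first by exists 0; rewrite iter_br0.
  by exists (a *: x + y); rewrite iter_br_lin.
(* Images of powers of [br b], with exponent at least 2 so that they lie in [A]. The smallest one,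
   of exponent [k.+2], is also the image of the doubled exponent. *)
pose P V := exists k, forall v, v \in V <-> exists x, v = iter k.+2 (br b) x.
have [V0 V0P] := imE 2.
have [|V [[k VP] _ minV]] := @ex_min_vspace _ _ P V0; first by exists 0%N.
have [V' V'P] := imE (k.+2 + k.+2)%N.
have eqV : V' = V.
  apply: minV; first by exists (k + k.+2)%N.
  by apply/subvP => v /V'P [x ->]; rewrite iterD; apply/VP; exists (iter k.+2 (br b) x).
apply: eq_fullv; apply/subvP => x _.
have : iter k.+2 (br b) x \in V' by rewrite eqV; apply/VP; exists x.
case/V'P => y; rewrite iterD => xy.
(* The first summand is in [A]; the difference is killed by the [k.+2]-th power of [br b], by the
   choice of [y]. *)
rewrite -[x](subrKC (iter k.+2 (br b) y)) memv_add //; first exact: bbA.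
apply/NP; exists k.+2.
rewrite iter_brD xy -[- iter _ _ _]scaleN1r -[_ *: _]addr0 iter_br_lin.
by rewrite iter_br0 addr0 scaleN1r addrN.
Qed.

Lemma solvable_primitive :
  solvable br fullv ->
  (primitive br <-> exists A, minimal_ideal br A /\ self_centralising br A).
Proof.
move=> solL; split=> [[M [maxM cfM]]|[A [minA scA]]].
  have [|A minimalA _] := minimal_ideal_exists ideal_full.
    case: maxM => _ Mf _; apply: contraNneq Mf => f0.
    by apply/eqP/eq_fullv; rewrite f0 sub0v.
  exists A; split=> //.
  have abA := solvable_minimal_abelian solL minimalA.
  by have [] := core_free_complement maxM cfM minimalA abA.
have [iA A0 minimalA] := minA.
have abA : abelian br A by move=> x y xA; move/scA: xA; apply.
(* A proper subalgebra supplementing [A]: zero if [A] is all of [L], otherwise a Fitting null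
   component. *)
have [N [sN Nf AN]] : exists N, [/\ subalg br N, N <> fullv & (A + N)%VS = fullv].
  case: (classic (fullv <= A)%VS) => [sfA|nsfA].
    exists 0%VS; split=> [x y||].
    - by rewrite !memv0 => /eqP -> _; rewrite br0l.
    - by move=> f0; case/negP: A0; rewrite -subv0 f0 subvf.
    by apply: eq_fullv; rewrite addv0.
  have [B [iB _ nsBA dBA]] := solvable_abelian_section ideal_full solL nsfA.
  (* If all of [B] acted nilpotently on [A], then [B] would centralise [A] and so lie in [A]. *)
  have [b [w [bB wA nilb]]] : exists b w,
      [/\ b \in B, w \in A & forall n, iter n (br b) w <> 0].
    apply: NNPP => nob; apply: nsBA; apply/subvP => b bB; apply/scA => a aA.
    apply: (nilpotent_centralises (M := fullv) (K := B)) (bB) (aA) => //.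
    - by apply: eq_fullv; rewrite addvSr.
    - by move=> m k _; apply: iB.
    - move=> k l c kB lB cA; apply: abA => //; apply: (subvP dBA).
      exact: mem_lie_brsp.
    move=> k c kB cA; apply: NNPP => nok; apply: nob; exists k, c; split=> // n kn.
    by apply: nok; exists n.
  have [|N [sN AN NP]] := @fitting_null_component b A.
    move=> x; apply: (subvP dBA); apply: mem_lie_brsp => //; exact: idealC.
  exists N; split=> // Nf.
  have /NP [n] : w \in N by rewrite Nf memvf.
  exact: nilb.
have [M maxM sNM] := maximal_subalg_exists sN Nf.
have [_ Mf _] := maxM.
have nsAM : ~ (A <= M)%VS.
  move=> sAM; case/negP: Mf; by apply/eqP/eq_fullv; rewrite -AN subv_add sAM.
have AM0 : (A :&: M)%VS = 0%VS.
  have [//|eqA] := minimalA _ (maximal_cap_ideal maxM iA abA nsAM) (capvSl _ _).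
  by case: nsAM; rewrite -eqA capvSr.
(* An ideal [I] inside [M] satisfies [[I, A] <= A :&: M = 0], so self-centralisation puts [I] in
   [A :&: M]. *)
exists M; split=> // I iI sIM; apply/eqP; rewrite -subv0 -AM0 subv_cap sIM andbT.
apply/subvP => i iI'; apply/scA => a aA; apply/eqP; rewrite -memv0 -AM0 memv_cap.
by rewrite iA //= (subvP sIM) // idealC.
Qed.

(** * Adjoint matrices and traces *)

Section Trace.
Import VectorInternalTheory.

(** Matrices act on row vectors from the right, so composition reverses the factors; hence the order
    in [ad_br]. *)
Definition ad x := \matrix_i v2r (br x (r2v (delta_mx 0 i))).

Lemma adE x v : v2r v *m ad x = v2r (br x v).
Proof.
rewrite -{2}[v]v2rK (row_sum_delta (v2r v)) linear_sum /=.
under [in RHS]eq_bigr do rewrite linearZ.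
rewrite br_sumr linear_sum {1}[v2r v]row_sum_delta mulmx_suml /=.
by apply: eq_bigr => i _; rewrite linearZ /= -scalemxAl -rowE rowK -row_sum_delta.
Qed.

Lemma v2r_mulmx_inj (M1 M2 : 'M[F]_(dim L)) :
  (forall v, v2r v *m M1 = v2r v *m M2) -> M1 = M2.
Proof. by move=> eqM; apply/row_matrixP => i; rewrite !rowE -[delta_mx 0 i]r2vK. Qed.

Lemma ad_lin (a : F) x y : ad (a *: x + y) = a *: ad x + ad y.
Proof.
apply: v2r_mulmx_inj => v.
by rewrite mulmxDr -scalemxAr !adE brP linearP.
Qed.

Lemma ad0 : ad 0 = 0.
Proof. by apply: v2r_mulmx_inj => v; rewrite adE br0l mulmx0 linear0. Qed.

Lemma ad_br x y : ad (br x y) = ad y *m ad x - ad x *m ad y.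
Proof.
apply: v2r_mulmx_inj => v; rewrite mulmxBr !mulmxA !adE -linearB /=.
by rewrite [br x (br y v)]br_deriv addrK.
Qed.

Lemma ad_iter x n v : v2r (iter n (br x) v) = v2r v *m ad x ^+ n.
Proof.
elim: n => [|n IHn]; first by rewrite expr0 mulmx1.
by rewrite iterS -adE IHn exprSr -mulmxE mulmxA.
Qed.

Lemma brsp_centralised_nilpotent U V y :
    [pchar F] =i pred0 -> y \in lie_brsp br U V ->
    (forall v, v \in V -> br v y = 0) ->
  forall x, exists n, iter n (br y) x = 0.
Proof.
move=> char0 yUV yV.
have [|n ady0] := trace_powers_nilpotent (A := ad y) char0; last first.
  by move=> x; exists n; apply: (can_inj v2rK); rewrite ad_iter ady0 mulmx0 linear0.
(* Replacing one factor [ad y] by [ad z] makes the trace linear in [z], so it suffices to take [z =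
   [u, v]]; there it vanishes by cyclicity, as [ad v] commutes with [ad y]. *)
move=> k; have [X XP] : exists X : {vspace L}, forall z,
    z \in X <-> \tr (ad z *m ad y ^+ k) = 0.
  apply: ex_vspace => [|a z t z0 t0].
    by rewrite ad0 mul0mx mxtrace0.
  by rewrite ad_lin mulmxDl -scalemxAl mxtraceD mxtraceZ z0 t0 mulr0 addr0.
rewrite exprS -mulmxE; apply/XP; apply: (subvP _ _ yUV).
apply: lie_brsp_sub => u v uU vV; apply/XP.
have comv : GRing.comm (ad v) (ad y).
  by apply/esym/eqP; rewrite -subr_eq0 -!mulmxE -ad_br yV // ad0.
rewrite ad_br mulmxBl linearB /= -!mulmxA [in X in _ - X]mulmxE.
have /= := commrX k comv; rewrite /GRing.comm -!mulmxE => ->.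
by rewrite mxtrace_mulC -mulmxA subrr.
Qed.

End Trace.

(** The socle of [A] under [br c] is stable under [M], which commutes with [br c]; it is then a
    nonzero ideal, hence [A]. A sum of simple subspaces is completely reducible. *)
Lemma acts_semisimply_of_commuting A M c :
    minimal_ideal br A -> abelian br A -> (A + M)%VS = fullv ->
    (forall m, m \in M -> br c m = 0) ->
  acts_semisimply br c A.
Proof.
move=> [iA A0 minA] abA AMf cM.
pose inv X := forall x, x \in X -> br c x \in X.
pose simp T := [/\ inv T, T != 0%VS, (T <= A)%VS &
  forall X, inv X -> (X <= T)%VS -> X != 0%VS -> X = T].
(* Says that [Q] lies in the sum of all simple subspaces, without forming that infinite sum; the
   maximal such [Q] is the socle. *)
pose in_socle Q := forall V, (forall T, simp T -> (T <= V)%VS) -> (Q <= V)%VS.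
have invI X Y : inv X -> inv Y -> inv (X :&: Y)%VS.
  by move=> iX iY x; rewrite !memv_cap => /andP [/iX -> /iY ->].
have invD X Y : inv X -> inv Y -> inv (X + Y)%VS.
  by move=> iX iY _ /memv_addP [x xX [y yY ->]]; rewrite brDr memv_add ?iX ?iY.
have [|Q [sQ _ maxQ]] := @ex_max_vspace _ _ in_socle 0%VS; first by move=> V _; apply: sub0v.
have simpQ T : simp T -> (T <= Q)%VS.
  move=> simpT; rewrite -(maxQ (T + Q)%VS) ?addvSl ?addvSr // => V simpV.
  by rewrite subv_add simpV // sQ.
have sQA : (Q <= A)%VS by apply: sQ => T [].
have commc m x : m \in M -> br c (br m x) = br m (br c x).
  by move=> mM; rewrite br_deriv cM // br0l add0r.
have stQ m x : m \in M -> x \in Q -> br m x \in Q.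
  move=> mM; have [X XP] : exists X : {vspace L}, forall x, x \in X <-> br m x \in Q.
    apply: ex_vspace => [|a y z yX zX]; first by rewrite br0r mem0v.
    by rewrite brPr memvD ?memvZ.
  suff /subvP sQX : (Q <= X)%VS by move/sQX/XP.
  apply: sQ => T [iT T0 sTA minT].
  (* The image of a simple [T] under [br m] is zero or simple: an invariant [Y] inside it pulls back
     to an invariant [T'] in [T]. *)
  have [mT mTP] : exists mT : {vspace L}, forall y,
      y \in mT <-> exists2 x, x \in T & y = br m x.
    apply: ex_vspace => [|a _ _ [y yT ->] [z zT ->]]; first by exists 0; rewrite ?mem0v ?br0r.
    by exists (a *: y + z); rewrite ?memvD ?memvZ // brPr.
  suff /subvP smTQ : (mT <= Q)%VS.
    by apply/subvP => y yT; apply/XP/smTQ/mTP; exists y.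
  have [->|mT0] := eqVneq mT 0%VS; first exact: sub0v.
  apply: simpQ; split=> //.
  - by move=> _ /mTP [y yT ->]; rewrite commc //; apply/mTP; exists (br c y); first exact: iT.
  - by apply/subvP => _ /mTP [y yT ->]; rewrite iA // (subvP sTA).
  move=> Y iY sYmT Y0; apply/eqP; rewrite eqEsubv sYmT /=.
  have [T' T'P] : exists T' : {vspace L}, forall y, y \in T' <-> y \in T /\ br m y \in Y.
    apply: ex_vspace => [|a y z [yT yY] [zT zY]]; first by rewrite br0r !mem0v.
    by rewrite brPr !memvD ?memvZ.
  suff eqT' : T' = T.
    by apply/subvP => _ /mTP [y yT ->]; rewrite -eqT' in yT; case/T'P: yT.
  apply: minT.
    by move=> y /T'P [yT yY]; apply/T'P; split; [apply: iT|rewrite -commc ?iY].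
    by apply/subvP => y /T'P [].
  have /(subvP sYmT) /mTP [y yT eqy] := memv_pick Y.
  apply: contraNneq Y0 => T'0; have : y \in T' by apply/T'P; rewrite -eqy memv_pick.
  by rewrite T'0 memv0 -vpick0 eqy => /eqP ->; rewrite br0r.
have Q_A : Q = A.
  have [|Q0|//] := minA Q _ sQA; first exact: (ideal_of_stable abA AMf sQA).
  have [|T [[iT T0 sTA] _ minT]] :=
      @ex_min_vspace _ _ (fun X => [/\ inv X, X != 0%VS & (X <= A)%VS]) A.
    by split=> // x; apply: iA.
  case/negP: (T0); rewrite -subv0 -Q0 simpQ //; split=> // X iX sXT X0.
  by apply: minT => //; split=> //; apply: subv_trans sTA.
move=> U sUA iU.
(* A maximal invariant [V] meeting [U] trivially is a complement: a simple [T] not inside [U + V]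
   meets it in zero, and then [T + V] could replace [V]. *)
have [|V [[iV sVA UV0] _ maxV]] := @ex_max_vspace _ _
    (fun V => [/\ inv V, (V <= A)%VS & (U :&: V)%VS = 0%VS]) 0%VS.
  by rewrite sub0v capv0; split=> // x; rewrite memv0 => /eqP ->; rewrite br0r mem0v.
exists V; split=> //; first exact/directv_addP.
apply/eqP; rewrite eqEsubv subv_add sUA sVA -{1}Q_A /=.
apply: sQ => T [iT T0 sTA minT].
have [cap0|capn0] := eqVneq (T :&: (U + V))%VS 0%VS; last first.
  by rewrite -(minT (T :&: (U + V))%VS) ?capvSl ?capvSr //; apply: invI => //; apply: invD.
suff <- : (T + V)%VS = V by apply: subv_trans (addvSr _ _); rewrite addvSl.
apply: maxV; last exact: addvSr.
split; [exact: invD | by rewrite subv_add sTA |].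
apply/eqP; rewrite -subv0; apply/subvP => u; rewrite memv_cap.
case/andP=> uU /memv_addP [t tT [v vV equ]].
have t0 : t = 0.
  apply/eqP; rewrite -memv0 -cap0 memv_cap tT /=.
  have -> : t = u - v by rewrite equ addrK.
  by rewrite memv_add // memvN.
by rewrite -UV0 memv_cap uU equ t0 add0r.
Qed.

(** * The complement [M] of [W], its centre [C] and the radical *)

Section PrimitiveStructure.
Variables W M C : {vspace L}.
Hypothesis char0 : [pchar F] =i pred0.
Hypotheses (minW : minimal_ideal br W) (abW : abelian br W).
Hypotheses (WM : (W + M)%VS = fullv) (WM0 : (W :&: M)%VS = 0%VS).
Hypothesis scW : self_centralising br W.
Hypothesis sM : subalg br M.
Hypothesis CP : forall x, x \in C <-> x \in M /\ forall m, m \in M -> br x m = 0.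

(** Such a [K] centralises [W], so it lies in [W :&: M]: this is where faithfulness of [M] on [W]
    enters. *)
Lemma nilpotent_stable_abelian_eq0 K :
    (K <= M)%VS -> (forall m k, m \in M -> k \in K -> br m k \in K) ->
    abelian br K -> (forall k x, k \in K -> exists n, iter n (br k) x = 0) ->
  K = 0%VS.
Proof.
move=> sKM stK abK nilK; apply/eqP; rewrite -subv0 -WM0 subv_cap sKM andbT.
apply/subvP => k kK; apply/scW => w wW.
apply: (nilpotent_centralises minW abW WM stK) kK wW => [l l' w' lK l'K _|l w' lK _].
  by rewrite (abK l l') // br0l.
exact: nilK.
Qed.

Lemma sub_centre : (C <= M)%VS.
Proof. by apply/subvP => x /CP []. Qed.

Lemma centre_commute m c : m \in M -> c \in C -> br m c = 0.
Proof. by move=> mM /CP [_ cM]; rewrite brC cM // oppr0. Qed.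

Lemma derived_cap_centre : (lie_brsp br M M :&: C)%VS = 0%VS.
Proof.
apply: nilpotent_stable_abelian_eq0.
- exact: subv_trans (capvSr _ _) sub_centre.
- by move=> m k mM; rewrite memv_cap => /andP [_ kC]; rewrite centre_commute ?mem0v.
- move=> k l; rewrite !memv_cap => /andP [_ kC] /andP [_ lC].
  by rewrite centre_commute ?(subvP sub_centre).
move=> k x; rewrite memv_cap => /andP [kMM kC].
by apply: (brsp_centralised_nilpotent char0 kMM) => m mM; apply: centre_commute.
Qed.

(** [[M, J]] lies in the abelian [J], so its elements commute with [J]; the trace argument makes
    them ad-nilpotent, whence [[M, J] = 0]. *)
Lemma abelian_stable_sub_centre J :
    (J <= M)%VS -> (forall m j, m \in M -> j \in J -> br m j \in J) ->
  abelian br J -> (J <= C)%VS.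
Proof.
move=> sJM stJ abJ.
have sKJ : (lie_brsp br M J <= J)%VS by apply: lie_brsp_sub.
have K0 : lie_brsp br M J = 0%VS.
  apply: nilpotent_stable_abelian_eq0.
  - exact: subv_trans sJM.
  - by move=> m k mM; apply: lie_brsp_stable => y ?; [apply: sM|apply: stJ].
  - by move=> k l /(subvP sKJ) kJ /(subvP sKJ) lJ; apply: abJ.
  move=> k x kK; apply: (brsp_centralised_nilpotent char0 kK) => j jJ.
  by apply: abJ => //; apply: (subvP sKJ).
apply/subvP => j jJ; apply/CP; split=> [|m mM]; first exact: (subvP sJM).
by apply/eqP; rewrite brC oppr_eq0 -memv0 -K0 mem_lie_brsp.
Qed.

Lemma mem_radical_cap x : x \in (W + C)%VS -> x \in M -> x \in C.
Proof.
move=> /memv_addP [w wW [c cC ->]] wcM.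
suff -> : w = 0 by rewrite add0r.
apply/eqP; rewrite -memv0 -WM0 memv_cap wW /=.
by rewrite -(addrK c w) memvB // (subvP sub_centre).
Qed.

Lemma solvable_ideal_sub_radical I : ideal br I -> solvable br I -> (I <= W + C)%VS.
Proof.
have [iW _ _] := minW.
move=> iI [n In]; elim: n I iI In => [|n IHn] I iI; first by move=> /= ->; apply: sub0v.
rewrite iterSr => /(IHn _ (ideal_lie_brsp iI iI)) sDI.
(* [J] is the projection of [I] to [M] along [W]. By induction [[J, J]] lies in [(W + C) :&: M = C]
   and in [[M, M]], so [J] is abelian and therefore central in [M]. *)
pose J := ((I + W) :&: M)%VS.
have sJC : (J <= C)%VS.
  apply: abelian_stable_sub_centre; first exact: capvSr.
    move=> m j mM; rewrite !memv_cap => /andP [jIW jM].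
    by rewrite (ideal_add iI iW) // sM.
  move=> x y; rewrite !memv_cap => /andP [xIW xM] /andP [yIW yM].
  apply/eqP; rewrite -memv0 -derived_cap_centre memv_cap mem_lie_brsp //=.
  apply: mem_radical_cap; last exact: sM.
  case/memv_addP: xIW => i iI' [w wW ->]; case/memv_addP: yIW => j jI [v vW ->].
  rewrite brDl brDr -addrA memvD //; first by rewrite (subvP sDI) // mem_lie_brsp.
  by rewrite (subvP (addvSl _ _)) //; apply: memvD; [apply: iW|apply: idealC].
apply/subvP => i iI'; have /memv_addP [w wW [m mM eqi]] : i \in (W + M)%VS by rewrite WM memvf.
rewrite eqi memv_add // (subvP sJC) // memv_cap mM andbT.
have -> : m = i - w by rewrite eqi addrC addKr.
by rewrite memv_add // memvN.
Qed.

Lemma radical_add_centre : radical br (W + C)%VS.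
Proof.
have [iW _ _] := minW.
split; last exact: solvable_ideal_sub_radical.
  move=> x _ /memv_addP [w wW [c cC ->]]; rewrite brDr.
  have /memv_addP [v vW [m mM ->]] : x \in (W + M)%VS by rewrite WM memvf.
  rewrite (brDl v m c) (centre_commute mM cC) addr0 (subvP (addvSl _ _)) //.
  by apply: memvD; [apply: iW|apply: idealC].
(* The first derived term lies in [W], and [W] is abelian. *)
exists 2; apply/eqP; rewrite -subv0 /=.
have sDW : (lie_brsp br (W + C) (W + C) <= W)%VS.
  apply: lie_brsp_sub => _ _ /memv_addP [w wW [c cC ->]] /memv_addP [v vW [d dC ->]].
  rewrite brDl (brDr c) (centre_commute _ dC) ?(subvP sub_centre) // addr0.
  by apply: memvD; [apply: idealC|apply: iW].
by apply: lie_brsp_sub => x y /(subvP sDW) xW /(subvP sDW) yW; rewrite abW ?mem0v.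
Qed.

(* Any subspace containing [M, M] is a subalgebra, so a Levi complement comes
   for free from [M, M] :&: C = 0. *)
Lemma centre_complement :
  exists S, [/\ subalg br S, (S <= M)%VS, (C :&: S)%VS = 0%VS & (C + S)%VS = M].
Proof.
pose D := lie_brsp br M M; pose E := (M :\: (D + C))%VS.
have sDM : (D <= M)%VS by apply: lie_brsp_sub.
have sEM : (E <= M)%VS by apply: diffvSl.
have sSM : (D + E <= M)%VS by rewrite subv_add sDM.
exists (D + E)%VS; split=> //.
- move=> x y /(subvP sSM) xM /(subvP sSM) yM.
  by rewrite (subvP (addvSl _ _)) // mem_lie_brsp.
- apply/eqP; rewrite -subv0 -derived_cap_centre; apply/subvP => x.
  rewrite memv_cap => /andP [xC /memv_addP [d dD [e eE eqx]]].
  (* [e] lies in both [E] and [D + C], which meet trivially. *)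
  suff e0 : e = 0 by rewrite memv_cap xC eqx e0 addr0 dD.
  apply/eqP; rewrite -memv0 -(capv_diff M (D + C)%VS) memv_cap eE /=.
  have -> : e = - d + x by rewrite eqx addKr.
  by rewrite memv_add ?memvN.
rewrite addvA [(C + D)%VS]addvC addvC addv_diff; apply/addv_idPl.
by rewrite subv_add sDM sub_centre.
Qed.

End PrimitiveStructure.

(** * Type 1 in characteristic zero *)

Lemma primitive_type1_char0 : [pchar F] =i pred0 ->
  (primitive_type1 br <->
   exists W C S : {vspace L},
     monolith br W /\ abelian br W /\
     subalg br C /\ abelian br C /\
     (forall c, c \in C -> acts_semisimply br c W) /\
     levi br S /\
     (forall c s, c \in C -> s \in S -> br c s = 0) /\
     directv (W + C + S)%VS /\
     (W + C + S)%VS = fullv).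
Proof.
move=> char0; split.
  move=> [[M [maxM cfM]] [W [monW abW]]]; have [minW _] := monW.
  have [WM WM0 scW] := core_free_complement maxM cfM minW abW.
  have [sM _ _] := maxM.
  have [C CP] : exists C : {vspace L}, forall x,
      x \in C <-> x \in M /\ forall m, m \in M -> br x m = 0.
    have [Z ZP] := centraliserE M; exists (M :&: Z)%VS => x; rewrite memv_cap.
    by split=> [/andP [xM /ZP]|[-> /ZP]].
  have sCM := sub_centre CP.
  have [S [sS sSM CS0 CSM]] := centre_complement char0 minW abW WM WM0 scW sM CP.
  have abC : abelian br C by move=> x y /CP [_ xM] /(subvP sCM); apply: xM.
  have WC0 : (W :&: C)%VS = 0%VS.
    by apply/eqP; rewrite -subv0 -WM0 capvS.
  have WCS0 : ((W + C) :&: S)%VS = 0%VS.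
    apply/eqP; rewrite -subv0 -CS0; apply/subvP => x; rewrite !memv_cap.
    case/andP=> xWC xS; rewrite xS andbT.
    by apply: (mem_radical_cap WM0 CP xWC); apply: (subvP sSM).
  have WCSf : (W + C + S)%VS = fullv by rewrite -addvA CSM.
  exists W, C, S; split=> //; split=> //; split; last split=> //; last split; last split.
  - by move=> x y xC yC; rewrite abC ?mem0v.
  - move=> c /CP [_ cM]; exact: (acts_semisimply_of_commuting minW abW WM).
  - exists (W + C)%VS; split=> //; last exact/directv_addP.
    exact: radical_add_centre char0 minW abW WM WM0 scW sM CP.
  split; first by move=> c s /CP [_ cM] /(subvP sSM); apply: cM.
  split=> //; rewrite directv_addE /= WCS0 eqxx andbT directv_trivial andbT.
  exact/directv_addP.
move=> [W [C [S [monW [abW [sC [abC [_ [leviS [CS [dir full]]]]]]]]]]].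
have [minW _] := monW; have [iW W0 minimalW] := minW.
split; last by exists W.
have sS : subalg br S by case: leviS => R [].
(* The commuting sum of [C] and [S] is the candidate core-free maximal subalgebra. *)
pose M := (C + S)%VS.
have WM : (W + M)%VS = fullv by rewrite addvA.
have WM0 : (W :&: M)%VS = 0%VS.
  move: dir; rewrite directv_addE /= => /and3P [/directv_addP WC0 _ /eqP WCS0]; apply/eqP.
  rewrite -subv0 -WC0; apply/subvP => x; rewrite !memv_cap.
  case/andP=> xW /memv_addP [c cC [s sS' eqx]]; rewrite xW /=.
  suff s0 : s = 0 by rewrite eqx s0 addr0.
  apply/eqP; rewrite -memv0 -WCS0 memv_cap sS' andbT.
  by rewrite -(addKr c s) -eqx addrC memv_add ?memvN.
have sM : subalg br M.
  move=> _ _ /memv_addP [c cC [s sS' ->]] /memv_addP [d dC [t tS ->]].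
  rewrite brDl (brDr c) (brDr s) abC // (CS c t) // addr0 add0r.
  by rewrite (brC s d) CS // oppr0 add0r (subvP (addvSr _ _)) // sS.
have nsWM : ~ (W <= M)%VS.
  by move/capv_idPl; rewrite WM0 => W00; rewrite -W00 eqxx in W0.
exists M; split; last exact: monolith_core_free nsWM.
split=> // [|V sV sMV].
  by apply/eqP => Mf; apply: nsWM; rewrite Mf subvf.
(* By the modular law a subalgebra [V] above [M] is [(W :&: V) + M], and minimality of [W] leaves
   only [M] and [L]. *)
have iWV : ideal br (W :&: V)%VS.
  apply: (ideal_of_stable abW WM (capvSl _ _)) => m x mM.
  by rewrite !memv_cap => /andP [xW xV]; rewrite iW ?sV // (subvP sMV).
have eqV : ((W :&: V) + M)%VS = V.
  by rewrite capvC vspace_modr // WM capvf.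
case: (minimalW _ iWV (capvSl _ _)) => eqWV; rewrite eqWV in eqV.
  by left; rewrite -eqV add0v.
by right; rewrite -eqV.
Qed.

End LieAlgebra.

Unset Implicit Arguments.

Theorem theorem1p5 (F : fieldType) (L : vectType F) (br : L -> L -> L)
  (hL : lie_algebra br) :
  [/\ (primitive_type1 br <->
        (exists W, monolith br W /\ abelian br W) /\ frattini_free br),
      ([pchar F] =i pred0 ->
        (primitive_type1 br <->
         exists W C S : {vspace L},
           monolith br W /\ abelian br W /\
           subalg br C /\ abelian br C /\
           (forall c, c \in C -> acts_semisimply br c W) /\
           levi br S /\
           (forall c s, c \in C -> s \in S -> br c s = 0) /\
           directv (W + C + S)%VS /\
           (W + C + S)%VS = fullv)) &
      (solvable br fullv ->
        (primitive br <-> exists A, minimal_ideal br A /\ self_centralising br A))].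
Proof.
split; first exact: primitive_type1_frattini.
  exact: primitive_type1_char0.
exact: solvable_primitive.
Qed.
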